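(* For all integers $\ell\ge 0$, $n\ge 0$ and $0\le k\le n$, $$A(\ell,n,k)=\frac{n!}{k!}\times\sum_{n_1,\ldots,n_k\ge 1}\mathbf{1}\{n_1+\cdots+n_k=n\}\times\prod_{i=1}^{k}\left[\frac{B(\ell,n_i)}{n_i}\right],$$ where the sum is over $k$-tuples of integers $n_1,\ldots,n_k\ge 1$, $\mathbf{1}\{\cdots\}$ denotes the indicator function of the condition between braces, and $B(\ell,\cdot)$ is the multiplicative function on positive integers (i.e., $B(\ell,1)=1$ and $B(\ell,ab)=B(\ell,a)B(\ell,b)$ whenever $a,b$ are coprime) which satisfies $$B(\ell,q^m)=\frac{(q^{\ell}-1)(q^{\ell+1}-1)\cdots(q^{\ell+m-1}-1)}{(q-1)(q^2-1)\cdots(q^m-1)}$$ for every integer $m\ge 0$ and every prime number $q$.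
   Context: For $n\ge 0$, $[n]=\{1,\ldots,n\}$ and $\mathfrak{S}_n$ is the group of permutations of $[n]$. For $\ell\ge 0$, let $\mathscr{C}_{\ell,n}$ be the set of ordered $\ell$-tuples $(\sigma_1,\ldots,\sigma_\ell)\in(\mathfrak{S}_n)^\ell$ with $\sigma_i\sigma_j=\sigma_j\sigma_i$ for all $i,j$. Let $\langle\sigma_1,\ldots,\sigma_\ell\rangle$ be the subgroup of $\mathfrak{S}_n$ generated by the tuple, and let $\kappa(\sigma_1,\ldots,\sigma_\ell)$ be the number of orbits of its action on $[n]$. For $0\le k\le n$, $\mathscr{C}_{\ell,n,k}$ is the set of tuples in $\mathscr{C}_{\ell,n}$ with $\kappa(\sigma_1,\ldots,\sigma_\ell)=k$, and $A(\ell,n,k):=|\mathscr{C}_{\ell,n,k}|$ is its cardinality. Conventions: empty products equal $1$ (so the formula for $B(\ell,q^m)$ gives $1$ when $m=0$); when $k=0$ the sum has a single term, indexed by the empty tuple, with $n_1+\cdots+n_k=0$. *)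

(* Defs.v *)
From mathcomp Require Import all_boot all_order all_algebra all_fingroup.

Set Implicit Arguments.
Unset Strict Implicit.
Unset Printing Implicit Defensive.

Import GRing.Theory.

Definition commuting_tuples (l n : nat) : {set l.-tuple 'S_n} :=
  [set s : l.-tuple 'S_n |
    [forall i, forall j, (tnth s i * tnth s j == tnth s j * tnth s i)%g]].

Definition kappa (l n : nat) (s : l.-tuple 'S_n) : nat :=
  #|orbit 'P <<[set x in s]>> @: [set: 'I_n]|.

Definition A (l n k : nat) : nat :=
  #|[set s in commuting_tuples l n | kappa s == k]|.

Local Open Scope ring_scope.

Definition multiplicative_nat (B : nat -> rat) : Prop :=
  B 1%N = 1 /\
  forall a b : nat, (0 < a)%N -> (0 < b)%N -> coprime a b ->
    B (a * b)%N = B a * B b.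

(* The subtractions are taken in rat; at l = 0 and 0 < m the factor i = 0 of
   the numerator vanishes. *)
Definition Bprime_power (l q m : nat) : rat :=
  (\prod_(i < m) (q%:R ^+ (l + i) - 1)) / (\prod_(i < m) (q%:R ^+ i.+1 - 1)).

(* B 0 is unconstrained: the functions of interest live on positive integers. *)
Definition is_B (l : nat) (B : nat -> rat) : Prop :=
  multiplicative_nat B /\
  forall q m : nat, prime q -> B (q ^ m)%N = Bprime_power l q m.

Lemma is_B_exists (l : nat) : exists B, is_B l B.
Proof.
exists (fun n => \prod_(p <- primes n) Bprime_power l p (logn p n)).
have B0 q : Bprime_power l q 0 = 1.
  by rewrite /Bprime_power !big_ord0 divr1.
split; first split=> [|a b a0 b0 cab].
- by rewrite big_nil.
- have /(perm_big _) -> : perm_eq (primes (a * b)) (primes a ++ primes b).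
    apply: uniq_perm; rewrite ?cat_uniq ?primes_uniq //=.
      by rewrite andbT -coprime_has_primes // coprime_sym.
    by move=> p; rewrite mem_cat primesM.
  rewrite big_cat /=; congr (_ * _); apply: eq_big_seq => p.
    rewrite mem_primes => /and3P[pp _ pa]; rewrite lognM //.
    by rewrite (@logn_coprime p b) ?addn0 // (coprime_dvdl pa).
  rewrite mem_primes => /and3P[pp _ pb]; rewrite lognM //.
  by rewrite (@logn_coprime p a) // (coprime_dvdl pb) // coprime_sym.
- move=> q [|m] pq; first by rewrite big_nil B0.
  by rewrite primesX // primes_prime // big_seq1 pfactorK.
Qed.

Lemma is_B_unique (l : nat) (B1 B2 : nat -> rat) :
  is_B l B1 -> is_B l B2 -> forall n, (0 < n)%N -> B1 n = B2 n.
Proof.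
move=> [[B11 B1M] B1X] [[B21 B2M] B2X]; elim/ltn_ind=> n IH n0.
have [n1|n1] := leqP n 1.
  by have -> : n = 1%N by [apply/eqP; rewrite eqn_leq n1]; rewrite B11 B21.
have pq := pdiv_prime n1; set q := pdiv n in pq.
have c : coprime n`_q n`_q^' by exact: coprime_partC.
rewrite -(partnC q n0) B1M ?part_gt0 // B2M ?part_gt0 //; congr (_ * _).
  by rewrite p_part B1X // B2X.
apply: IH; last exact: part_gt0.
rewrite -[X in (_ < X)%N](partnC q n0) ltn_Pmull ?part_gt0 //.
by rewrite p_part -[1%N](expn0 q) ltn_exp2l ?prime_gt1 // logn_gt0 mem_primes pq n0 pdiv_dvd.
Qed.

(* Main.v *)
(** The (l+1)-tuples are treated as pairs (s, t) of an l-tuple s and one more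
permutation t. Fix a point x0, let U be its orbit under s, of size d, and s0
the restriction of s to U. If t preserves U, it acts on U by one of the d
elements of the regular group generated by s0, and what remains is a commuting
tuple on the complement of U with one orbit less. Otherwise V = t(U) is
disjoint from U; composing t with the involution exchanging u and t(u) for u in
U short-circuits V and leaves a commuting tuple on the complement of V with as
many orbits. Iterating, with b_l(d) (d-1)! transitive l-tuples on U, the number
of tuples on n points with k+1 orbits is (n-1)! times the sum over m of
b_(l+1)(m) A(l+1,n-m,k)/(n-m)!, where b_(l+1)(m) is the sum of d b_l(d) over
d | m. This is the recursion satisfied by n!/k! [x^n] f^k with
f = sum_m b_(l+1)(m) x^m/m, as one sees by differentiating f^(k+1). Finally the
divisor sum defining b_(l+1) from b_l is multiplicative, and it telescopes on
prime powers to the stated product. *)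

Require Import Defs.
From mathcomp Require Import all_boot all_order all_algebra all_fingroup.
From mathcomp Require Import ring.

Set Implicit Arguments.
Unset Strict Implicit.
Unset Printing Implicit Defensive.

Import GRing.Theory Num.Theory.

(** * Orbits of commuting tuples *)

Definition orb (T : finType) (A : {set {perm T}}) (x : T) : {set T} :=
  orbit 'P <<A>> x.

Definition norb (T : finType) (A : {set {perm T}}) (S : {set T}) : nat :=
  #|orb A @: S|.

Lemma orb_refl (T : finType) (A : {set {perm T}}) x : x \in orb A x.
Proof. exact: orbit_refl. Qed.

Lemma orb_perm (T : finType) (A : {set {perm T}}) p x :
  p \in A -> orb A (p x) = orb A x.
Proof. by move=> pA; rewrite /orb -(orbit_act 'P x (mem_gen pA)). Qed.

Lemma eq_orb (T : finType) (A : {set {perm T}}) x y :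
  y \in orb A x -> orb A y = orb A x.
Proof. by move/(@orbit_eqP _ _ 'P%act). Qed.

(** The permutations that preserve [f] form a group, so it is enough to test the generators. *)
Lemma orb_invariant (T : finType) (R : eqType) (A : {set {perm T}})
    (f : T -> R) :
    (forall p, p \in A -> forall x, f (p x) = f x) ->
  forall x y, y \in orb A x -> f y = f x.
Proof.
move=> fA x y /orbitP[g gA <-] /=; rewrite apermE.
pose H := [set g : {perm T} | [forall x, f (g x) == f x]].
have gH : group_set H.
  apply/group_setP; split=> [|a b].
    by rewrite inE; apply/forallP=> z; rewrite perm1.
  rewrite !inE => /forallP fa /forallP fb; apply/forallP=> z.
  by rewrite permM (eqP (fb _)) (eqP (fa _)).
have : (<<A>> \subset Group gH)%g.
  rewrite gen_subG; apply/subsetP=> p pA; rewrite inE.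
  by apply/forallP=> z; rewrite fA.
by move/subsetP/(_ g gA); rewrite inE => /forallP/(_ x)/eqP.
Qed.

(** An invariant function factors through the orbits. [norb_split] and [norb_splice] use this bound
    in both directions. *)
Lemma card_imset_le_norb (T R : finType) (A : {set {perm T}}) (S : {set T})
    (f : T -> R) :
    (forall p, p \in A -> forall x, f (p x) = f x) ->
  (#|f @: S| <= norb A S)%N.
Proof.
move=> fA; pose h (W : {set T}) := omap f [pick y in W].
have hE x : h (orb A x) = Some (f x).
  rewrite /h; case: pickP => [y /(orb_invariant fA) /= -> //|/(_ x)].
  by rewrite orb_refl.
have Sinj : injective (@Some R) by move=> a b [].
rewrite -(card_imset (f @: S) Sinj).
have -> : Some @: (f @: S) = h @: (orb A @: S).
  by rewrite -!imset_comp; apply: eq_imset => x /=; rewrite hE.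
exact: leq_imset_card.
Qed.

(** Permutations of a fixed ambient type supported in [S] stand for permutations of [S], so
    shrinking [S] in the inductions never changes the type. *)
Definition commuting_on (T : finType) l (S : {set T}) (s : l.-tuple {perm T}) :
    bool :=
  [forall i, perm_on S (tnth s i)] &&
  [forall i, forall j, (tnth s i * tnth s j == tnth s j * tnth s i)%g].

Definition ctuples (T : finType) l (S : {set T}) k : {set l.-tuple {perm T}} :=
  [set s : l.-tuple {perm T} | commuting_on S s & norb [set x in s] S == k].

Lemma commuting_onP (T : finType) l (S : {set T}) (s : l.-tuple {perm T}) :
  reflect ((forall i, perm_on S (tnth s i)) /\
           (forall i j, commute (tnth s i) (tnth s j)))
          (commuting_on S s).
Proof.
apply: (iffP andP) => -[h1 h2]; split; try by apply/forallP.
  by move=> i j; apply/eqP; apply: (forallP (forallP h2 i) j).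
by apply/forallP=> i; apply/forallP=> j; apply/eqP; apply: h2.
Qed.

Definition gens (T : finType) l (p : l.-tuple {perm T} * {perm T}) :
    {set {perm T}} :=
  p.2 |: [set x in p.1].

Definition commuting_pair (T : finType) l (S : {set T})
    (p : l.-tuple {perm T} * {perm T}) : bool :=
  [&& commuting_on S p.1, perm_on S p.2 &
      [forall i, (p.2 * tnth p.1 i == tnth p.1 i * p.2)%g]].

Lemma commuting_pairP (T : finType) l (S : {set T})
    (p : l.-tuple {perm T} * {perm T}) :
  reflect [/\ forall i, perm_on S (tnth p.1 i),
              forall i j, commute (tnth p.1 i) (tnth p.1 j),
              perm_on S p.2 & forall i, commute p.2 (tnth p.1 i)]
          (commuting_pair S p).
Proof.
apply: (iffP and3P) => [[/commuting_onP[h1 h2] h3 /forallP h4]|[h1 h2 h3 h4]].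
  by split=> // i; apply/eqP.
split=> //; first exact/commuting_onP.
by apply/forallP=> i; apply/eqP/h4.
Qed.

Lemma gensP (T : finType) l (p : l.-tuple {perm T} * {perm T}) q :
  reflect (q = p.2 \/ exists i, q = tnth p.1 i) (q \in gens p).
Proof.
rewrite !inE; apply: (iffP orP) => [[/eqP|/tnthP]|[->|[i ->]]]; auto.
by right; apply: mem_tnth.
Qed.

Definition cpairs (T : finType) l (S : {set T}) k :
    {set l.-tuple {perm T} * {perm T}} :=
  [set p | commuting_pair S p & norb (gens p) S == k].

Lemma card_cpairs (T : finType) l (S : {set T}) k :
  #|ctuples l.+1 S k| = #|cpairs l S k|.
Proof.
pose f (p : l.-tuple {perm T} * {perm T}) : l.+1.-tuple {perm T} :=
  [tuple of p.2 :: p.1].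
have f_inj : injective f.
  by move=> [s t] [s' t'] /(congr1 val)[-> /val_inj ->].
have f_surj s : exists p, s = f p.
  by exists ([tuple of behead s], thead s); rewrite /f /= -tuple_eta.
have fE p : (f p \in ctuples l.+1 S k) = (p \in cpairs l S k).
  rewrite !inE; congr (_ && (norb _ S == k)); last first.
    by apply/setP=> q; rewrite !inE.
  have f0 : tnth (f p) ord0 = p.2 by [].
  have fS i : tnth (f p) (lift ord0 i) = tnth p.1 i by rewrite tnthS.
  apply/commuting_onP/commuting_pairP => [[h1 h2]|[h1 h2 h3 h4]].
    split=> [i|i j||i]; rewrite -?fS -?f0 //.
  split=> [i|i j].
    by have [j ->|->] := unliftP ord0 i; rewrite ?f0 ?fS.
  have [i' ->|->] := unliftP ord0 i; have [j' ->|->] := unliftP ord0 j;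
    rewrite ?f0 ?fS //.
  by apply: commute_sym.
have <- : f @: cpairs l S k = ctuples l.+1 S k.
  apply/setP=> s; have [p ->] := f_surj s.
  by rewrite (mem_imset _ _ f_inj) fE.
by rewrite card_imset.
Qed.

Lemma perm_on_fix (T : finType) (S : {set T}) (p : {perm T}) :
  (forall x, x \notin S -> p x = x) -> perm_on S p.
Proof.
by move=> pS; apply/subsetP=> x; rewrite inE; apply: contraNT => /pS->.
Qed.

Lemma perm_on_subset (T : finType) (S1 S2 : {set T}) (p : {perm T}) :
  S1 \subset S2 -> perm_on S1 p -> perm_on S2 p.
Proof. by move=> s12 p1; apply: subset_trans s12. Qed.

(** An injection of the finite set [U] into itself is onto, so no outside point can enter [U]. *)
Lemma mem_perm_stable (T : finType) (U : {set T}) (p : {perm T}) x :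
  (forall u, u \in U -> p u \in U) -> (p x \in U) = (x \in U).
Proof.
move=> pU; suff pUE : p @: U = U by rewrite -{1}pUE (mem_imset _ _ perm_inj).
apply/eqP; rewrite eqEcard card_imset ?leqnn ?andbT; last exact: perm_inj.
by apply/subsetP=> _ /imsetP[u uU ->]; apply: pU.
Qed.

(** The points of [U] share one [A]-orbit, which stays in [U]. Off [U] the members of [A] and [B]
    are the same maps, so the other orbits correspond. *)
Lemma norb_split (T : finType) (A B : {set {perm T}}) (S U : {set T}) x0 :
    U \subset S -> x0 \in U -> (forall x, x \in U -> orb A x = orb A x0) ->
    (forall a x, a \in A -> x \in U -> a x \in U) ->
    (forall b x, b \in B -> x \in U -> b x = x) ->
    (forall a, a \in A ->
      exists2 b, b \in B & forall x, x \notin U -> a x = b x) ->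
    (forall b, b \in B ->
      exists2 a, a \in A & forall x, x \notin U -> b x = a x) ->
  norb A S = (norb B (S :\: U)).+1.
Proof.
move=> US x0U AU0 AU BU AB BA.
have AUE a x : a \in A -> (a x \in U) = (x \in U).
  by move=> aA; apply: mem_perm_stable => u; apply: AU.
have -> : norb A S = #|orb A x0 |: orb A @: (S :\: U)|.
  apply: eq_card => W; rewrite !inE; apply/imsetP/orP => [[x xS ->]|].
    have [xU|xU] := boolP (x \in U); first by left; rewrite AU0.
    by right; apply: imset_f; rewrite inE xU.
  case=> [/eqP ->|/imsetP[x]]; first by exists x0 => //; apply: (subsetP US).
  by rewrite inE => /andP[_ xS] ->; exists x.
rewrite cardsU1 (_ : (_ \notin _) = true) ?add1n; last first.
  apply/imsetP=> -[x]; rewrite inE => /andP[xU _] E.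
  have x0x : x0 \in orb A x by rewrite -E orb_refl.
  have := @orb_invariant _ _ A (fun z => z \in U)
    (fun a aA z => AUE a z aA) _ _ x0x.
  by rewrite x0U (negPf xU).
congr _.+1; apply/eqP; rewrite eqn_leq; apply/andP; split.
  apply: card_imset_le_norb => b bB x.
  have [xU|xU] := boolP (x \in U); first by rewrite BU.
  by have [a aA ->] := BA b bB; rewrite ?orb_perm.
(* Collapsing [U] to [set0] makes the [B]-orbit map invariant under [A] everywhere, not only off
   [U]. *)
pose f x := if x \in U then set0 else orb B x.
have -> : norb B (S :\: U) = #|f @: (S :\: U)|.
  congr #|pred_of_set _|; apply: eq_in_imset => x.
  by rewrite inE /f => /andP[/negPf->].
apply: card_imset_le_norb => a aA x; rewrite /f AUE //.
case: ifPn => // xU; have [b bB ->] := AB a aA; rewrite ?orb_perm //.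
Qed.

(** [h] retracts [S] onto [S :\: V] within [A]-orbits. As [orb A] is [B]-invariant and [orb B] after
    [h] is [A]-invariant, each count bounds the other. *)
Lemma norb_splice (T : finType) (A B : {set {perm T}}) (S V : {set T})
    (h : T -> T) :
    (forall x, x \in S -> h x \in S :\: V) ->
    (forall x, x \notin V -> h x = x) ->
    (forall x, orb A (h x) = orb A x) ->
    (forall a x, a \in A -> orb B (h (a x)) = orb B (h x)) ->
    (forall b x, b \in B -> orb A (b x) = orb A x) ->
  norb A S = norb B (S :\: V).
Proof.
move=> hS hV hA hB BA; apply/eqP; rewrite eqn_leq; apply/andP; split.
  have -> : norb A S = #|orb A @: (S :\: V)|.
    apply: eq_card => W; apply/imsetP/imsetP => -[x xS ->].
      by exists (h x); rewrite ?hA ?hS.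
    by exists x => //; move: xS; rewrite inE => /andP[].
  by apply: card_imset_le_norb => b bB x; apply: BA.
have -> : norb B (S :\: V) = #|(fun x => orb B (h x)) @: (S :\: V)|.
  congr #|pred_of_set _|; apply: eq_in_imset => x.
  by rewrite inE => /andP[/hV->].
apply: leq_trans (_ : #|(fun x => orb B (h x)) @: S| <= _)%N.
  by apply/subset_leq_card/imsetS/subsetDl.
by apply: card_imset_le_norb => a aA x; apply: hB.
Qed.

Definition agree (T : finType) l (U : {set T}) (s0 s : l.-tuple {perm T}) :
    bool :=
  [forall i, forall u in U, tnth s i u == tnth s0 i u].

Lemma agreeP (T : finType) l (U : {set T}) (s0 s : l.-tuple {perm T}) :
  reflect (forall i u, u \in U -> tnth s i u = tnth s0 i u) (agree U s0 s).
Proof.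
apply: (iffP forallP) => h i; first by move=> u /(forall_inP (h i))/eqP.
by apply/forall_inP=> u uU; apply/eqP/h.
Qed.

(** * Detaching an orbit *)

(** The entries of [p.1] alone connect [U]. The orbit may be larger than [U], since [p.2] need not
    preserve [U]. *)
Lemma orb_agree (T : finType) l (U : {set T}) (s0 : l.-tuple {perm T})
    (p : l.-tuple {perm T} * {perm T}) x0 :
    commuting_on U s0 -> orb [set q in s0] x0 = U -> agree U s0 p.1 ->
  forall x, x \in U -> orb (gens p) x = orb (gens p) x0.
Proof.
move=> /commuting_onP[s0U _] UE /agreeP ag x; rewrite -UE.
apply: orb_invariant => q; rewrite inE => /tnthP[i ->] y.
have [yU|yU] := boolP (y \in U); last by rewrite (out_perm (s0U i)).
by rewrite -ag // orb_perm //; apply/gensP; right; exists i.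
Qed.

Section Detach.
Variables (T : finType) (l : nat) (S U : {set T}) (x0 : T).
Variables (s0 : l.-tuple {perm T}) (r : {perm T}).
Hypotheses (US : U \subset S) (s0c : commuting_on U s0).
Hypotheses (UE : orb [set q in s0] x0 = U).
Hypotheses (rU : perm_on U r) (rc : forall i, commute r (tnth s0 i)).

(** Glues [s0] and [r], acting on [U], to a pair acting on [S :\: U]; disjoint supports make the
    factors commute. *)
Let attach (p : l.-tuple {perm T} * {perm T}) :=
  ([tuple tnth p.1 i * tnth s0 i | i < l], p.2 * r)%g.

Let attach_inj : injective attach.
Proof.
move=> [s t] [s' t'] E.
congr (_, _); last by have /= /mulIg := congr1 snd E.
apply: eq_from_tnth => i; have := congr1 (fun q => tnth q.1 i) E.
by rewrite !tnth_mktuple => /mulIg.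
Qed.

Let UC : [disjoint S :\: U & U].
Proof. by rewrite -setI_eq0 setIDAC setDIl setDv setI0. Qed.

Let s0U i : perm_on U (tnth s0 i). Proof. by case/commuting_onP: s0c. Qed.
Let s0C i j : commute (tnth s0 i) (tnth s0 j).
Proof. by case/commuting_onP: s0c. Qed.

Let attach_fwd p : commuting_pair (S :\: U) p ->
  [/\ commuting_pair S (attach p), agree U s0 (attach p).1 &
      forall u, u \in U -> (attach p).2 u = r u].
Proof.
case: p => s t /commuting_pairP[/= sS sC tS tC].
have out (q : {perm T}) u : perm_on (S :\: U) q -> u \in U -> q u = u.
  by move=> qS uU; rewrite (out_perm qS) // inE uU.
split; last by move=> u uU; rewrite permM (out t).
  have W q : perm_on (S :\: U) q -> perm_on S q.
    exact: perm_on_subset (subsetDl S U).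
  have X q : perm_on U q -> perm_on S q by apply: (perm_on_subset US).
  apply/commuting_pairP; split=> [i|i j||i] /=; rewrite ?tnth_mktuple.
  - by apply: perm_onM; [apply: W | apply: X].
  - have cs a b := perm_onC (sS a) (s0U b) UC.
    by apply: commuteM; apply: commute_sym; apply: commuteM => //;
      apply: commute_sym.
  - by apply: perm_onM; [apply: W | apply: X].
  - apply: commuteM; apply: commute_sym; apply: commuteM => //.
    + exact/commute_sym.
    + exact: perm_onC (sS i) rU UC.
    + exact/commute_sym/(perm_onC tS (s0U i) UC).
    + exact/commute_sym.
by apply/agreeP=> i u uU; rewrite tnth_mktuple permM (out (tnth s i)).
Qed.

Let attach_bwd p : commuting_pair S (attach p) -> agree U s0 (attach p).1 ->
    (forall u, u \in U -> (attach p).2 u = r u) ->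
  commuting_pair (S :\: U) p.
Proof.
case: p => s t /commuting_pairP[/= sS sC tS tC] /agreeP /= ag tr.
have sE i : tnth s i = (tnth (attach (s, t)).1 i * (tnth s0 i)^-1)%g.
  by rewrite /attach /= tnth_mktuple mulgK.
have tE : t = ((attach (s, t)).2 * r^-1)%g by rewrite /= mulgK.
have X q : perm_on U q -> perm_on S q by apply: (perm_on_subset US).
have onD q : perm_on S q -> (forall u, u \in U -> q u = u) ->
    perm_on (S :\: U) q.
  move=> qS qU; apply: perm_on_fix => x; rewrite inE negb_and negbK.
  by case/orP => [/qU //|]; apply: out_perm.
have sD i : perm_on (S :\: U) (tnth s i).
  apply: onD => [|u uU]; last first.
    by apply: (@perm_inj _ (tnth s0 i)); rewrite -(ag i u uU) tnth_mktuple permM.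
  by rewrite sE; apply: perm_onM => //; apply/perm_onV/X.
have tD : perm_on (S :\: U) t.
  apply: onD => [|u uU]; last by apply: (@perm_inj _ r); rewrite -(tr u uU) permM.
  by rewrite tE; apply: perm_onM => //; apply/perm_onV/X.
have cs a b : commute (tnth s a) (tnth s0 b) := perm_onC (sD a) (s0U b) UC.
have cr a : commute (tnth s a) r := perm_onC (sD a) rU UC.
have ct b : commute t (tnth s0 b) := perm_onC tD (s0U b) UC.
(* Commutation passes through [sE] and [tE]: the glued entries commute, and the factors on [U]
   commute with [s] and [t] by disjointness of supports. *)
apply/commuting_pairP; split=> //= i.
  move=> j; rewrite [in X in commute _ X]sE; apply: commuteM; last exact/commuteV.
  apply: commute_sym; rewrite [in X in commute _ X]sE; apply: commuteM => //.
  apply/commuteV; rewrite tnth_mktuple; apply: commute_sym.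
  by apply: commuteM => //; apply: commute_sym.
rewrite [in X in commute _ X]sE; apply: commuteM; last exact/commuteV.
apply: commute_sym; rewrite [X in commute _ X]tE; apply: commuteM => //.
  exact/commute_sym.
apply/commuteV; rewrite tnth_mktuple; apply: commute_sym.
by apply: commuteM => //; apply: commute_sym.
Qed.

Let norb_attach p : commuting_pair (S :\: U) p ->
  norb (gens (attach p)) S = (norb (gens p) (S :\: U)).+1.
Proof.
move=> pc; have [ac aag ar] := attach_fwd pc.
case: p pc ac aag ar => s t /commuting_pairP[/= sS sC tS tC] _ aag ar.
have x0U : x0 \in U by rewrite -UE orb_refl.
have AB q q' : perm_on (S :\: U) q -> perm_on U q' ->
    forall x, x \notin U -> (q * q')%g x = q x.
  move=> qS qU x xU; rewrite permM (out_perm qU) //.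
  by rewrite mem_perm_stable // => u uU; rewrite (out_perm qS) // inE uU.
apply: (@norb_split _ _ _ _ _ x0) => //.
- exact: (@orb_agree _ _ _ _ (attach (s, t)) _ s0c UE aag).
- move=> q x /gensP[->|[i ->]] xU; first by rewrite ar // perm_closed.
  by rewrite (agreeP _ _ _ aag) // perm_closed.
- by move=> q x /gensP[->|[i ->]] xU; rewrite (out_perm (S:= S :\: U)) // inE xU.
- move=> q /gensP[->|[i ->]].
    by exists t; [apply/gensP; left | apply: AB].
  exists (tnth s i); first by apply/gensP; right; exists i.
  by rewrite tnth_mktuple; apply: AB.
- move=> q /gensP[->|[i ->]].
    by exists (t * r)%g; [apply/gensP; left | move=> x xU; rewrite AB].
  exists (tnth s i * tnth s0 i)%g => [|x xU]; last by rewrite AB.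
  by apply/gensP; right; exists i; rewrite tnth_mktuple.
Qed.

(** [attach] is an injection of a finite type into itself, hence a bijection, so counting a preimage
    suffices; [U] accounts for exactly one orbit. *)
Lemma card_detach k :
  #|[set p in cpairs l S k.+1 |
      agree U s0 p.1 && [forall u in U, p.2 u == r u]]|
  = #|cpairs l (S :\: U) k|.
Proof.
rewrite -(card_preimset _ attach_inj); apply: eq_card => p; rewrite !inE.
apply/andP/andP=> [[/andP[pc /eqP pn] /andP[pa /forall_inP pr]]|[pc /eqP pn]].
  have pc' : commuting_pair (S :\: U) p.
    by apply: attach_bwd => // u /pr/eqP.
  by split=> //; move: pn; rewrite norb_attach // => -[->].
have [ac aag ar] := attach_fwd pc.
rewrite ac norb_attach // pn eqxx aag; split=> //=.
by apply/forall_inP=> u uU; rewrite [_ u]ar.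
Qed.

End Detach.

(** * Short-circuiting a translate of an orbit *)

Section Splice.
Variables (T : finType) (l : nat) (S U V : {set T}).
Variables (s0 : l.-tuple {perm T}) (w : {perm T}).
Hypotheses (US : U \subset S) (VS : V \subset S) (UV : [disjoint U & V]).
Hypotheses (s0c : commuting_on U s0) (wK : involutive w).
Hypotheses (wU : forall u, u \in U -> w u \in V).
Hypotheses (wV : forall v, v \in V -> w v \in U).
Hypotheses (wout : forall x, x \notin U -> x \notin V -> w x = x).

Let copy i : {perm T} := (w * tnth s0 i * w)%g.
(** Products act from left to right. When [p.2] fixes [V], a point [u] of [U] now goes to [w u], and
    [w u] goes to [p.2 u]: [V] is inserted between [U] and its former image. *)
Let splice (p : l.-tuple {perm T} * {perm T}) :=
  ([tuple tnth p.1 i * copy i | i < l], w * p.2)%g.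

Let splice_inj : injective splice.
Proof.
move=> [s t] [s' t'] E.
congr (_, _); last by have /= /mulgI := congr1 snd E.
apply: eq_from_tnth => i; have := congr1 (fun q => tnth q.1 i) E.
by rewrite !tnth_mktuple => /mulIg.
Qed.

Let s0U i : perm_on U (tnth s0 i). Proof. by case/commuting_onP: s0c. Qed.
Let s0C i j : commute (tnth s0 i) (tnth s0 j).
Proof. by case/commuting_onP: s0c. Qed.

Let notV u : u \in U -> u \notin V.
Proof. by move=> uU; apply: contraTN uU => /(disjointFl UV)->. Qed.
Let notU v : v \in V -> v \notin U.
Proof. by move=> vV; apply: contraTN vV => /(disjointFr UV)->. Qed.

Let copyE i x : copy i x = w (tnth s0 i (w x)).
Proof. by rewrite !permM. Qed.

Let copyV i : perm_on V (copy i).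
Proof.
apply: perm_on_fix => x xV; rewrite copyE (out_perm (s0U i)) ?wK //.
have [xU|xU] := boolP (x \in U); first exact/notU/wU.
by rewrite wout.
Qed.

Let copyC i j : commute (copy i) (copy j).
Proof.
apply/permP=> x; rewrite !permM !wK; congr (w _).
by have /permP/(_ (w x)) := s0C i j; rewrite !permM.
Qed.

Let wS : perm_on S w.
Proof.
apply: perm_on_fix => x xS; apply: wout; apply: contra xS => xS.
  exact: (subsetP US).
exact: (subsetP VS).
Qed.

(** The action forced on [U] and [V] together. It alone implies commutation with [w], with [s0] and
    with the copies. *)
Let acts i (q : {perm T}) :=
  (forall u, u \in U -> q u = tnth s0 i u) /\
  (forall v, v \in V -> q v = copy i v).

Let acts_U i q x : acts i q -> (q x \in U) = (x \in U).
Proof.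
by case=> qU qV; apply: mem_perm_stable => u uU; rewrite qU ?perm_closed.
Qed.

Let acts_V i q x : acts i q -> (q x \in V) = (x \in V).
Proof.
by case=> qU qV; apply: mem_perm_stable => u uU; rewrite qV ?perm_closed.
Qed.

Let acts_w i q : acts i q -> commute q w.
Proof.
move=> qa; have [qU qV] := qa; apply/permP=> x; rewrite !permM.
have [xU|xU] := boolP (x \in U); first by rewrite qU // qV ?wU // copyE wK.
have [xV|xV] := boolP (x \in V).
  by rewrite qV // copyE wK qU ?wV.
by rewrite (wout xU xV) wout ?(acts_U x qa) ?(acts_V x qa).
Qed.

Let acts_s0 i j q : acts i q -> commute q (tnth s0 j).
Proof.
move=> qa; have [qU qV] := qa; apply/permP=> x; rewrite !permM.
have [xU|xU] := boolP (x \in U).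
  rewrite !qU ?perm_closed //.
  by have /permP/(_ x) := s0C i j; rewrite !permM.
by rewrite (out_perm (s0U j) xU) (out_perm (s0U j)) ?(acts_U x qa).
Qed.

Let acts_copy i j q : acts i q -> commute q (copy j).
Proof.
move=> qa; apply: commuteM; last exact: acts_w qa.
by apply: commuteM; [apply: acts_w qa | apply: acts_s0 qa].
Qed.

Let splice_acts p i : commuting_pair (S :\: V) p -> agree U s0 p.1 ->
  acts i (tnth p.1 i * copy i)%g.
Proof.
move=> /commuting_pairP[sS _ _ _] /agreeP ag; split=> [u uU|v vV].
  by rewrite permM ag // (out_perm (copyV i)) // notV // perm_closed.
by rewrite permM (out_perm (sS i)) // inE vV.
Qed.

Let splice_fwd p : commuting_pair (S :\: V) p -> agree U s0 p.1 ->
  [/\ commuting_pair S (splice p), agree U s0 (splice p).1 &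
      forall u, u \in U -> (splice p).2 u = w u].
Proof.
move=> pc pa; have sa i := splice_acts i pc pa.
case: p pc pa sa => s t /commuting_pairP[/= sS sC tS tC] _ sa.
have VC : [disjoint S :\: V & V].
  by rewrite -setI_eq0 setIDAC setDIl setDv setI0.
have W q : perm_on (S :\: V) q -> perm_on S q.
  exact: perm_on_subset (subsetDl S V).
have cS i : perm_on S (copy i) by apply: (perm_on_subset VS).
split.
- apply/commuting_pairP; split=> [i|i j||i] /=; rewrite ?tnth_mktuple.
  + by apply: perm_onM => //; apply: W.
  + have cs a b : commute (tnth s a) (copy b) := perm_onC (sS a) (copyV b) VC.
    by apply: commuteM; apply: commute_sym; apply: commuteM => //;
      apply: commute_sym.
  + by apply: perm_onM => //; apply: W.
  + apply: commute_sym; apply: commuteM; first exact: acts_w (sa i).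
    apply: commute_sym; apply: commuteM => //.
    exact: perm_onC tS (copyV i) VC.
- by apply/agreeP=> i u uU; rewrite tnth_mktuple; case: (sa i) => ->.
- by move=> u uU; rewrite permM (out_perm tS) // inE wU.
Qed.

Let splice_bwd p : commuting_pair S (splice p) -> agree U s0 (splice p).1 ->
    (forall u, u \in U -> (splice p).2 u = w u) ->
  commuting_pair (S :\: V) p /\ agree U s0 p.1.
Proof.
case: p => s t /commuting_pairP[/= + + tS tC] /agreeP /= + tw.
pose r i := (tnth s i * copy i)%g.
have rE i : tnth [tuple tnth s i * copy i | i < l]%g i = r i by rewrite tnth_mktuple.
move=> rS rC ra.
have {}rS i : perm_on S (r i) by rewrite -rE.
have {}rC i j : commute (r i) (r j) by rewrite -!rE.
have {}ra i u : u \in U -> r i u = tnth s0 i u by rewrite -rE; apply: ra.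
have {}tC i : commute (w * t)%g (r i) by rewrite -rE.
have tE x : t x = (w * t)%g (w x) by rewrite permM wK.
have {}sE i : tnth s i = (r i * (copy i)^-1)%g by rewrite mulgK.
(* On [V] the action is forced: [r i] commutes with [w * t], which carries [w v] in [U] to [v]. *)
have acr i : acts i (r i).
  split=> [u uU|v vV]; first exact: ra.
  have {1}-> : v = (w * t)%g (w v) by rewrite tw ?wK ?wV.
  have /permP/(_ (w v)) := tC i; rewrite [LHS]permM => ->.
  rewrite [LHS]permM ra ?wV // tw; last by rewrite perm_closed ?wV.
  by rewrite copyE.
have onD q : perm_on S q -> (forall v, v \in V -> q v = v) ->
    perm_on (S :\: V) q.
  move=> qS qV; apply: perm_on_fix => x; rewrite inE negb_and negbK.
  by case/orP => [/qV //|]; apply: out_perm.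
have cS i : perm_on S (copy i) by apply: (perm_on_subset VS).
have sD i : perm_on (S :\: V) (tnth s i).
  apply: onD => [|v vV]; first by rewrite sE; apply: perm_onM => //; apply/perm_onV.
  by apply: (@perm_inj _ (copy i)); rewrite -((acr i).2 v vV) [RHS]permM.
have tD : perm_on (S :\: V) t.
  apply: onD => [|v vV]; last by rewrite tE tw ?wV ?wK.
  have -> : t = (w * (w * t))%g by apply/permP=> x; rewrite !permM wK.
  exact: perm_onM.
have cC i j : commute (r i) (copy j) := acts_copy j (acr i).
have wr i : commute w (r i) := commute_sym (acts_w (acr i)).
have VC : [disjoint S :\: V & V].
  by rewrite -setI_eq0 setIDAC setDIl setDv setI0.
split; last first.
  apply/agreeP=> i u uU; apply: (@perm_inj _ (copy i)).
  rewrite -permM [LHS]ra // (out_perm (copyV i)) //.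
  by rewrite notV // perm_closed.
apply/commuting_pairP; split=> //= i.
  move=> j; rewrite !sE; apply: commuteM; last apply/commuteV.
    by apply: commute_sym; apply: commuteM => //; apply/commuteV.
  apply: commute_sym; apply: commuteM; last exact/commuteV.
  exact/commute_sym.
rewrite sE; apply: commuteM.
  have -> : t = (w * (w * t))%g by apply/permP=> x; rewrite !permM wK.
  by apply: commute_sym; apply: commuteM; apply: commute_sym.
by apply/commuteV/(perm_onC tD (copyV i) VC).
Qed.

Let norb_spliced p : commuting_pair (S :\: V) p -> agree U s0 p.1 ->
  norb (gens (splice p)) S = norb (gens p) (S :\: V).
Proof.
move=> pc pa; have sa i := splice_acts i pc pa.
have [/commuting_pairP[_ _ + _] _ tw] := splice_fwd pc pa.
case: p pc pa sa tw => s t /commuting_pairP[/= sS sC tS tC] /agreeP ag sa tw wtS.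
have genw : (w * t)%g \in gens (splice (s, t)) by apply/gensP; left.
have gent : t \in gens (s, t) by apply/gensP; left.
have genr i : (tnth s i * copy i)%g \in gens (splice (s, t)).
  by apply/gensP; right; exists i; rewrite tnth_mktuple.
have genst i : tnth s i \in gens (s, t) by apply/gensP; right; exists i.
(* On [U] the involution [w] coincides with the generator [w * t], so it moves points within
   orbits. *)
have ow x : orb (gens (splice (s, t))) (w x) = orb (gens (splice (s, t))) x.
  have oU u : u \in U ->
      orb (gens (splice (s, t))) (w u) = orb (gens (splice (s, t))) u.
    by move=> uU; rewrite -(tw _ uU) orb_perm.
  have [/oU //|xU] := boolP (x \in U).
  have [xV|xV] := boolP (x \in V); last by rewrite wout.
  by rewrite -(oU _ (wV xV)) wK.
have sV i x : x \notin V -> (tnth s i * copy i)%g x = tnth s i x.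
  move=> xV; rewrite permM (out_perm (copyV i)) // mem_perm_stable // => v vV.
  by rewrite (out_perm (sS i)) // inE vV.
have tV x : (t x \in V) = (x \in V).
  by apply: mem_perm_stable => v vV; rewrite (out_perm tS) // inE vV.
(* The retraction brings [V] back to [U] along [w]; by [ow] it stays within orbits. *)
apply: (@norb_splice _ _ _ _ _ (fun x => if x \in V then w x else x)).
- move=> x xS; rewrite inE; case: ifPn => xV; last by rewrite xV.
  by rewrite notV ?wV // perm_closed.
- by move=> x /negPf->.
- by move=> x; case: ifP.
- move=> q x /gensP[->|[i ->]] /=; rewrite ?tnth_mktuple.
    rewrite permM tV; have [xU|xU] := boolP (x \in U).
      rewrite wU // (negPf (notV xU)) (out_perm tS) ?wK //.
      by rewrite inE wU.
    have [xV|xV] := boolP (x \in V); last by rewrite wout // (negPf xV) orb_perm.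
    by rewrite (negPf (notV (wV xV))) orb_perm.
  rewrite (acts_V x (sa i)); case: ifPn => xV; last by rewrite sV // orb_perm.
  have /permP/(_ x) := acts_w (sa i); rewrite [LHS]permM [RHS]permM => ->.
  by rewrite sV ?notV ?wV // orb_perm.
- move=> q x /gensP[->|[i ->]] /=.
    have -> : t x = (w * t)%g (w x) by rewrite permM wK.
    by rewrite orb_perm.
  have [xV|xV] := boolP (x \in V); last by rewrite -sV // orb_perm.
  by rewrite (out_perm (sS i)) // inE xV.
Qed.

(** The number of orbits is unchanged because [V] joins the orbits that meet [U]. On the right [p.2]
    is free on [U]: its values there become the values on [V] on the left. *)
Lemma card_splice k :
  #|[set p in cpairs l S k |
      agree U s0 p.1 && [forall u in U, p.2 u == w u]]|
  = #|[set p in cpairs l (S :\: V) k | agree U s0 p.1]|.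
Proof.
rewrite -(card_preimset _ splice_inj); apply: eq_card => p; rewrite !inE.
apply/andP/andP=> [[/andP[pc pn] /andP[pa /forall_inP pr]]|[/andP[pc pn] pa]].
  have [|pc' pa'] := splice_bwd pc pa; first by move=> u /pr/eqP.
  by rewrite pc' -norb_spliced.
have [ac aag ar] := splice_fwd pc pa.
rewrite ac norb_spliced // pn aag; split=> //=.
by apply/forall_inP=> u uU; rewrite [_ u]ar.
Qed.

End Splice.

(** * Counting the extensions of a transitive tuple *)

Lemma card_fibers (aT rT : finType) (A : {set aT}) (B : {pred rT})
    (f : aT -> rT) :
    (forall x, x \in A -> f x \in B) ->
  #|A| = \sum_(y in B) #|[set x in A | f x == y]|.
Proof.
move=> fAB; rewrite -sum1_card (partition_big f (mem B)) //.
by apply: eq_bigr => y _; rewrite -sum1_card; apply: eq_bigl => x; rewrite inE.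
Qed.

Lemma restr_perm_eq (T : finType) (U : {set T}) (q : {perm T}) :
  (forall u, u \in U -> q u \in U) -> forall u, u \in U -> restr_perm U q u = q u.
Proof.
move=> qU u uU; apply: restr_permE => //; rewrite !inE /=.
by apply/subsetP=> v vU; rewrite inE /= apermE qU.
Qed.

Lemma involution_extending (T : finType) (U : {set T})
    (g : {ffun {x | x \in U} -> T}) :
    injective g -> (forall u, g u \notin U) ->
  exists w : {perm T},
    [/\ involutive w, forall u, w (val u) = g u &
        forall x, x \notin U -> x \notin g @: setT -> w x = x].
Proof.
move=> g_inj gU.
(* [w] follows [g] on [U], runs back along [g] on its image, and fixes all other points. *)
pose w x := if insub x is Some u then g u
            else if [pick u | g u == x] is Some u then val u else x.
have wval u : w (val u) = g u by rewrite /w valK.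
have wg u : w (g u) = val u.
  rewrite /w insubN ?gU //; case: pickP => [v /eqP/g_inj-> //|/(_ u)].
  by rewrite eqxx.
have wout x : x \notin U -> x \notin g @: setT -> w x = x.
  move=> xU xg; rewrite /w insubN //; case: pickP => // u /eqP xE.
  by rewrite -xE imset_f in xg.
have wK : involutive w.
  move=> x; have [xU|xU] := boolP (x \in U).
    by rewrite -[x](SubK {x | x \in U} xU) wval wg.
  have [/imsetP[u _ ->]|xg] := boolP (x \in g @: setT); first by rewrite wg wval.
  by rewrite !wout.
exists (perm (inv_inj wK)); split=> [x|u|x xU xg]; rewrite !permE //.
exact: wout.
Qed.

Section Fiber.
Variables (T : finType) (l : nat) (S U : {set T}) (x0 : T).
Variables (s0 : l.-tuple {perm T}).
Hypotheses (US : U \subset S) (s0c : commuting_on U s0).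
Hypotheses (UE : orb [set q in s0] x0 = U).

Let s0U i : perm_on U (tnth s0 i). Proof. by case/commuting_onP: s0c. Qed.
Let s0C i j : commute (tnth s0 i) (tnth s0 j).
Proof. by case/commuting_onP: s0c. Qed.
Let x0U : x0 \in U. Proof. by rewrite -UE orb_refl. Qed.

Lemma invariant_on_U (R : eqType) (f : T -> R) :
    (forall i u, u \in U -> f (tnth s0 i u) = f u) ->
  forall u, u \in U -> f u = f x0.
Proof.
move=> fU u; rewrite -UE; apply: orb_invariant => q; rewrite inE => /tnthP[i ->] x.
have [xU|xU] := boolP (x \in U); first exact: fU.
by rewrite (out_perm (s0U i)).
Qed.

Let Z : {set {perm T}} :=
  [set r | perm_on U r && [forall i, (r * tnth s0 i == tnth s0 i * r)%g]].

Let ZP r : reflect (perm_on U r /\ forall i, commute r (tnth s0 i)) (r \in Z).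
Proof.
rewrite inE; apply: (iffP andP) => -[rU rC]; split=> //.
  by move=> i; apply/eqP/(forallP rC).
by apply/forallP=> i; apply/eqP/rC.
Qed.

(* A transitive abelian group acts regularly and is its own centralizer. *)
Lemma card_centralizer : #|Z| = #|U|.
Proof.
have inj : {in Z &, injective (fun r : {perm T} => r x0)}.
  move=> r r' /ZP[rU rC] /ZP[rU' rC'] E; apply/permP=> x.
  have [xU|xU] := boolP (x \in U); last by rewrite !(@out_perm _ U).
  apply/eqP; rewrite (@invariant_on_U _ (fun x => r x == r' x)) ?E ?eqxx //.
  move=> i u uU /=.
  have /permP/(_ u) := rC i; have /permP/(_ u) := rC' i.
  by rewrite !permM => <- <-; rewrite (inj_eq perm_inj).
rewrite -(card_in_imset inj); apply: eq_card => y.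
apply/imsetP/idP => [[r /ZP[rU _] ->]|]; first by rewrite perm_closed.
rewrite -UE => /orbitP[g gA <-]; exists g; rewrite ?[LHS]apermE //.
set A := [set q in s0] in gA.
apply/ZP; split.
  have : (<<A>> \subset Sym U)%g.
    rewrite gen_subG; apply/subsetP=> q; rewrite !inE => /tnthP[i ->].
    exact: s0U.
  by move/subsetP/(_ g gA); rewrite inE.
move=> i; have iA : tnth s0 i \in A by rewrite inE mem_tnth.
have AC : (<<A>> \subset 'C(A))%g.
  rewrite gen_subG; apply/subsetP=> q; rewrite inE => /tnthP[j ->].
  by apply/centP=> q'; rewrite inE => /tnthP[j' ->]; apply: s0C.
by apply: (centP (subsetP AC g gA)).
Qed.

(** Pairs are sorted by the restriction of [p.2] to [U]: either one of the [#|U|] elements of [Z],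
    or an injection into [S :\: U], counted by the falling factorial. The value [c] is left abstract
    so that the lemma can be iterated. *)
Lemma card_extensions k c :
    (forall V : {set T}, V \subset S :\: U -> #|V| = #|U| ->
      #|[set p in cpairs l (S :\: V) k.+1 | agree U s0 p.1]| = c) ->
  #|[set p in cpairs l S k.+1 | agree U s0 p.1]| =
    #|U| * #|cpairs l (S :\: U) k| + #|S :\: U| ^_ #|U| * c.
Proof.
move=> hc; set M := [set p in _ | _].
have MP p : p \in M -> [/\ p \in cpairs l S k.+1, commuting_pair S p &
     agree U s0 p.1].
  by rewrite !inE => /andP[/andP[-> ->] ->].
(* [p.2] commutes with a tuple that preserves [U] and is transitive on it, so the image of [x0]
   decides for all of [U]. *)
have sU p u : p \in M -> u \in U -> (p.2 u \in U) = (p.2 x0 \in U).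
  move=> /MP[_ /commuting_pairP[_ _ _ pc] /agreeP pa] uU.
  apply: (@invariant_on_U _ (fun x => p.2 x \in U)) => // i v vU.
  have /permP/(_ v) := pc i; rewrite !permM -pa // => <-.
  apply: mem_perm_stable => z zU; rewrite pa // perm_closed //.
rewrite -(cardsID [set p : l.-tuple {perm T} * {perm T} | p.2 x0 \in U] M).
congr (_ + _).
  rewrite (@card_fibers _ _ _ (mem Z) (fun p => restr_perm U p.2)).
    rewrite -card_centralizer -sum_nat_const; apply: eq_bigr => r /ZP[rU rC].
    rewrite -(card_detach US s0c UE rU rC); apply: eq_card => p.
    rewrite inE [in LHS]inE [in LHS]inE [RHS]inE.
    have [pM|pM] := boolP (p \in M); last first.
      apply/esym/negbTE; apply: contra pM; rewrite [p \in M]inE.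
      by case/and3P=> -> ->.
    have [pc _ ->] := MP p pM; rewrite pc /=; have x0UE := sU p _ pM.
    apply/andP/forall_inP => [[x0p /eqP <-] u uU|h].
      by rewrite restr_perm_eq // => v /x0UE ->.
    have {}h u : u \in U -> p.2 u = r u by move/h/eqP.
    have x0p : p.2 x0 \in U by rewrite h // perm_closed.
    split=> //; apply/eqP/permP=> u; have [uU|uU] := boolP (u \in U).
      by rewrite restr_perm_eq ?h // => v /x0UE ->.
    by rewrite (out_perm rU) // (out_perm (restr_perm_on _ _)).
  move=> p; rewrite inE inE => /andP[pM x0p].
  have [_ /commuting_pairP[_ _ _ pc] /agreeP pa] := MP p pM.
  have rE : {in U, restr_perm U p.2 =1 p.2}.
    by apply: restr_perm_eq => u uU; rewrite (sU p).
  apply/ZP; split; first exact: restr_perm_on.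
  move=> i; apply/permP=> x; rewrite !permM.
  have [xU|xU] := boolP (x \in U); last first.
    by rewrite !(out_perm (restr_perm_on _ _)) ?perm_closed // (out_perm (s0U i)).
  rewrite !rE ?perm_closed // -!pa ?(sU p) //.
  by have /permP/(_ x) := pc i; rewrite !permM.
(* Here [p.2] sends all of [U] outside [U]. Each injection extends to an involution [w], to which
   [card_splice] applies. *)
pose F (p : l.-tuple {perm T} * {perm T}) := [ffun u : {x | x \in U} => p.2 (val u)].
pose B : {pred {ffun {x | x \in U} -> T}} :=
  [pred g in [set g in ffun_on (mem (S :\: U)) | injectiveb g]].
rewrite (@card_fibers _ _ _ B F); last first.
  move=> p; rewrite !inE => /andP[x0p pM].
  have /MP[_ /commuting_pairP[_ _ pS _] _] : p \in M by rewrite !inE.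
  apply/andP; split.
    apply/ffun_onP=> u; rewrite ffunE !inE (sU p) ?x0p ?perm_closed ?(valP u) //=.
      exact: (subsetP US) (valP u).
    by rewrite !inE.
  by apply/injectiveP=> u v; rewrite !ffunE => /perm_inj/val_inj.
rewrite (eq_bigr (fun _ => c)) => [|g].
  rewrite sum_nat_const; congr (_ * _).
  rewrite -[#|U| in RHS](_ : #|{: {x | x \in U}}| = _); last by rewrite card_sig.
  rewrite -card_inj_ffuns_on; apply: eq_card => g; rewrite !inE; congr (_ && _).
rewrite !inE => /andP[/ffun_onP gS /injectiveP g_inj].
have gU u : g u \notin U by have := gS u; rewrite inE => /andP[].
have [w [wK wg wout]] := involution_extending g_inj gU.
pose V := g @: setT.
have VSU : V \subset S :\: U by apply/subsetP=> _ /imsetP[u _ ->].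
have VE : #|V| = #|U| by rewrite card_imset // cardsT card_sig.
have UV : [disjoint U & V].
  rewrite disjoint_sym disjoint_subset; apply/subsetP=> _ /imsetP[u _ ->].
  by rewrite inE gU.
have wU u : u \in U -> w u \in V.
  by move=> uU; rewrite -[u](SubK {x | x \in U} uU) wg imset_f.
have wV v : v \in V -> w v \in U.
  by case/imsetP=> u _ ->; rewrite -wg wK (valP u).
have VS := subset_trans VSU (subsetDl S U).
rewrite -(hc V VSU VE) -(card_splice US VS UV s0c wK wU wV wout).
apply: eq_card => p; rewrite inE [in LHS]inE [in LHS]inE [RHS]inE.
have [pM|pM] := boolP (p \in M); last first.
  rewrite andbF /=; apply/esym/negbTE; apply: contra pM; rewrite [p \in M]inE.
  by case/and3P=> -> ->.
have [pc _ ->] := MP p pM; rewrite pc andbT /=.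
apply/andP/forall_inP => [[_ /eqP gE] u uU|h].
  by rewrite -[u](SubK {x | x \in U} uU) wg -gE ffunE.
split; last by apply/eqP/ffunP=> u; rewrite ffunE -wg; apply/eqP/h/valP.
rewrite (eqP (h _ x0U)); apply: contraTN (wU _ x0U) => wx0.
by rewrite (disjointFr UV).
Qed.

End Fiber.

(** * The recursion on the number of orbits *)

Lemma orb_sub (T : finType) l (U : {set T}) (s : l.-tuple {perm T}) x0 :
    (forall i u, u \in U -> tnth s i u \in U) -> x0 \in U ->
  orb [set q in s] x0 \subset U.
Proof.
move=> sU x0U; apply/subsetP=> x.
have inv q : q \in [set q in s] -> forall x, (q x \in U) = (x \in U).
  rewrite inE => /tnthP[i ->] y; exact/mem_perm_stable/sU.
by move/(@orb_invariant _ _ _ (fun x => x \in U) inv) => /= ->.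
Qed.

Lemma ctuples1E (T : finType) l (U : {set T}) x0 : x0 \in U ->
  ctuples l U 1 =
  [set s : l.-tuple {perm T} | commuting_on U s & orb [set q in s] x0 == U].
Proof.
move=> x0U; apply/setP=> s; rewrite !inE; apply: andb_id2l.
case/commuting_onP=> sU _; apply/cards1P/eqP => [[W WE]|UE].
  apply/eqP; rewrite eqEsubset orb_sub //; last first.
    by move=> i u uU; rewrite perm_closed.
  apply/subsetP=> x xU.
  have oW y : y \in U -> orb [set q in s] y = W.
    by move=> yU; apply/set1P; rewrite -WE imset_f.
  by rewrite oW // -(oW x) // orb_refl.
exists U; apply/setP=> W; rewrite inE; apply/imsetP/eqP => [[x xU ->]|->].
  by rewrite (eq_orb (x := x0)) ?UE.
by exists x0.
Qed.

(** Each pair is filed under the orbit of [x0] under [p.1] and the restriction of [p.1] to that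
    orbit, which is transitive there. *)
Lemma card_cpairs_by_orbit (T : finType) l (S : {set T}) x0 k : x0 \in S ->
  #|cpairs l S k| =
    \sum_(U : {set T} | (x0 \in U) && (U \subset S))
      \sum_(s0 in ctuples l U 1) #|[set p in cpairs l S k | agree U s0 p.1]|.
Proof.
move=> x0S; pose O (p : l.-tuple {perm T} * {perm T}) := orb [set q in p.1] x0.
pose f (p : l.-tuple {perm T} * {perm T}) :=
  (O p, [tuple restr_perm (O p) (tnth p.1 i) | i < l] : l.-tuple {perm T}).
pose B (y : {set T} * l.-tuple {perm T}) :=
  [&& x0 \in y.1, y.1 \subset S & y.2 \in ctuples l y.1 1].
have Ostable (p : l.-tuple {perm T} * {perm T}) i u :
    u \in O p -> tnth p.1 i u \in O p.
  move=> uO; rewrite /O -(eq_orb uO) -(@orb_perm _ _ (tnth p.1 i)) ?orb_refl //.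
  by rewrite inE mem_tnth.
have tE p i u : u \in O p -> tnth (f p).2 i u = tnth p.1 i u.
  by move=> uO; rewrite tnth_mktuple restr_perm_eq // => v; apply: Ostable.
have ton p i : perm_on (O p) (tnth (f p).2 i).
  by rewrite tnth_mktuple restr_perm_on.
have x0O p : x0 \in O p by rewrite orb_refl.
have fB p : p \in cpairs l S k -> f p \in B.
  rewrite inE => /andP[/commuting_pairP[pS pC _ _] _].
  rewrite unfold_in /= x0O orb_sub //=; last by move=> i u; rewrite perm_closed.
  rewrite (ctuples1E _ (x0O p)) inE; apply/andP; split.
    apply/commuting_onP; split=> // i j; apply/permP=> x; rewrite !permM.
    have [xO|xO] := boolP (x \in O p); last by rewrite !(@out_perm _ (O p)).
    rewrite !tE ?Ostable //.
    by have /permP/(_ x) := pC i j; rewrite !permM.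
  rewrite eqEsubset orb_sub //=; last by move=> i u; rewrite perm_closed.
  (* The orbit [V] under the restricted entries lies in [O p], where both actions coincide; so [V]
     is stable under [p.1] and contains [O p]. *)
  set V := orb [set q in [tuple _ | i < l]] x0.
  have VO : V \subset O p by apply: orb_sub => // i u; rewrite perm_closed.
  apply: orb_sub; last exact: orb_refl.
  move=> i u uV; rewrite -tE ?(subsetP VO) //.
  rewrite /V -(eq_orb uV) -(@orb_perm _ _ (tnth (f p).2 i)) ?orb_refl //.
  by rewrite inE mem_tnth.
rewrite (card_fibers fB) pair_big_dep /=.
apply: eq_big => [[U s0]|[U s0]]; rewrite unfold_in /B /= andbA // => HB.
apply: eq_card => p; rewrite [in LHS]inE [in RHS]inE; apply: andb_id2l => pc.
case/andP: HB => /andP[x0U US]; rewrite (ctuples1E _ x0U) inE.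
case/andP=> s0c /eqP UE; have [s0U _] := commuting_onP _ _ s0c.
apply/eqP/agreeP => [[<- <-] i u uO|pa].
  by rewrite -(tE p i u uO).
have OU : O p = U.
  apply/eqP; rewrite eqEsubset orb_sub //=; last first.
    by move=> i u uU; rewrite pa // perm_closed.
  rewrite -UE; apply: orb_sub; last exact: orb_refl.
  have OU : O p \subset U.
    by apply: orb_sub => // i u uU; rewrite pa // perm_closed.
  by move=> i u uO; rewrite -pa ?Ostable // (subsetP OU).
rewrite /f OU; congr (_, _); apply: eq_from_tnth => i; rewrite tnth_mktuple.
apply/permP=> u; have [uU|uU] := boolP (u \in U).
  rewrite restr_perm_eq ?pa // => v vU; by rewrite pa // perm_closed.
by rewrite (out_perm (s0U i)) // (out_perm (restr_perm_on _ _)).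
Qed.

Lemma sum_subsets_by_card (T : finType) (W : {set T}) (g : nat -> rat) :
  (\sum_(A : {set T} | A \subset W) g #|A| =
   \sum_(e < #|W|.+1) 'C(#|W|, e)%:R * g e)%R.
Proof.
rewrite (partition_big (fun A : {set T} => inord #|A| : 'I_#|W|.+1) predT) //=.
apply: eq_bigr => e _; rewrite -cards_draws -[X in (X%:R * _)%R]sum1_card natr_sum.
rewrite mulr_suml; apply: eq_big => [A|A /andP[AW /eqP <-]]; rewrite ?inE.
  apply: andb_id2l => AW; rewrite -val_eqE /= inordK // ltnS.
  exact: subset_leq_card.
by rewrite mul1r inordK // ltnS subset_leq_card.
Qed.

Lemma sum_subsets_with_point (T : finType) (S : {set T}) x0 (g : nat -> rat) :
    x0 \in S ->
  (\sum_(U : {set T} | (x0 \in U) && (U \subset S)) g #|U| =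
   \sum_(e < #|S|) 'C(#|S|.-1, e)%:R * g e.+1)%R.
Proof.
move=> x0S; have cS : #|S| = #|S :\ x0|.+1 by rewrite (cardsD1 x0) x0S.
rewrite [in RHS]cS /= -(sum_subsets_by_card _ (fun e => g e.+1)).
rewrite (reindex_onto (fun A => x0 |: A) (fun U => U :\ x0)) => [|U /andP[xU _]];
  last by rewrite setD1K.
apply: eq_big => A; last first.
  by case/andP=> _ /eqP AE; rewrite cardsU1 -{1}AE !inE eqxx.
rewrite !inE eqxx subUset sub1set x0S /= subsetD1; apply: andb_id2l => _.
apply/eqP/idP => [<-|xA]; first by rewrite !inE eqxx.
by rewrite setU1K.
Qed.

Section MultipleSums.
Local Open Scope ring_scope.

Lemma sum_multiples_lt (a : nat -> rat) d n : (n < d)%N ->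
  \sum_(1 <= m < n.+1 | (d %| m)%N) a m = 0.
Proof.
move=> nd; rewrite big_nat_cond big1 // => m /andP[/andP[m0 mn] dm].
by have := dvdn_leq m0 dm; rewrite leqNgt (leq_trans mn nd).
Qed.

(** Mirrors one use of [card_extensions]: the term [m = d] is the detached part, the remaining sum
    the spliced part. *)
Lemma sum_multiples_shift (a : nat -> rat) d n : (0 < d)%N -> (d <= n)%N ->
  \sum_(1 <= m < n.+1 | (d %| m)%N) a (n - m)%N =
  a (n - d)%N + \sum_(1 <= m < (n - d).+1 | (d %| m)%N) a (n - d - m)%N.
Proof.
move=> d0 dn; rewrite (big_cat_nat (n := d.+1)) //=; congr (_ + _).
  rewrite big_mkcond big_nat_recr //= dvdnn -big_mkcond.
  case: d d0 dn => // d _ dn.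
  by rewrite (@sum_multiples_lt (fun m => a (n - m)%N)) ?add0r.
rewrite -{1}(addn1 d) addnC big_addn subSn //; apply: eq_big => [m|m _].
  by rewrite dvdn_addl.
by rewrite -subnDA [(d + m)%N]addnC.
Qed.

End MultipleSums.

(** [card_extensions] unrolled: every splice and the final detachment remove [#|U|] points, and [m]
    is the total removed. The falling factorials and the factorial of what remains multiply to
    [(#|S| - #|U|)!]; the detachment contributes [#|U|]. *)
Lemma card_agree (T : finType) l k N (a : nat -> rat) (U : {set T}) x0
    (s0 : l.-tuple {perm T}) :
    commuting_on U s0 -> orb [set q in s0] x0 = U ->
    (forall S : {set T}, #|S| < N ->
      (#|cpairs l S k|%:R = #|S|`!%:R * a #|S| :> rat)%R) ->
  forall S : {set T}, #|S| <= N -> U \subset S ->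
    (#|[set p in cpairs l S k.+1 | agree U s0 p.1]|%:R =
     (#|S| - #|U|)%N`!%:R * #|U|%:R *
       \sum_(1 <= m < #|S|.+1 | (#|U| %| m)%N) a (#|S| - m)%N :> rat)%R.
Proof.
move=> s0c UE ha S; have [n le_n] := ubnP #|S|.
elim: n => // n IH in S le_n *; move=> SN US.
have x0U : x0 \in U by rewrite -UE orb_refl.
have U0 : 0 < #|U| by apply/card_gt0P; exists x0.
have cSU : #|S :\: U| = #|S| - #|U|.
  by rewrite cardsD (setIidPr US).
have US_le : #|U| <= #|S| by apply: subset_leq_card.
have cSU_lt : #|S :\: U| < #|S|.
  by rewrite cSU -{2}(subnK US_le) -addn1 leq_add2l.
rewrite sum_multiples_shift //.
have [small|big] := ltnP #|S :\: U| #|U|.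
  (* No [V] of the size of [U] fits into [S :\: U], so the condition on [c] is vacuous and 0 will
     do. *)
  rewrite (@card_extensions _ _ _ _ x0 _ US s0c UE _ 0) => [|V VS cV].
    rewrite muln0 addn0 natrM ha; last exact: leq_trans SN.
    rewrite (@sum_multiples_lt (fun m => a (#|S| - #|U| - m))) ?addr0 -?cSU //.
    by rewrite mulrA [(_ * _%:R)%R]mulrC.
  by have := subset_leq_card VS; rewrite cV leqNgt small.
have val (V : {set T}) : V \subset S :\: U -> #|V| = #|U| ->
    (#|[set p in cpairs l (S :\: V) k.+1 | agree U s0 p.1]|%:R =
     (#|S :\: U| - #|U|)%N`!%:R * #|U|%:R *
       \sum_(1 <= m < #|S :\: U|.+1 | (#|U| %| m)%N) a (#|S :\: U| - m)%N :> rat)%R.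
  move=> VSU cV; have /andP[VS VU] : (V \subset S) && [disjoint V & U].
    by rewrite -subsetD.
  have cSV : #|S :\: V| = #|S :\: U|.
    by rewrite cSU cardsD (setIidPr VS) cV.
  rewrite -cSV IH // ?cSV //.
  - exact: leq_trans cSU_lt _.
  - exact: leq_trans (ltnW cSU_lt) SN.
  - by rewrite subsetD US disjoint_sym.
(* [c] must be a natural number while the common value is known in [rat]; the count for one sample
   set [V0] serves. *)
have : 0 < #|[set V : {set T} | V \subset S :\: U & #|V| == #|U|]|.
  by rewrite cards_draws bin_gt0.
case/card_gt0P=> V0; rewrite inE => /andP[V0S /eqP cV0].
rewrite (@card_extensions _ _ _ _ x0 _ US s0c UE _
  #|[set p in cpairs l (S :\: V0) k.+1 | agree U s0 p.1]|) => [|V VS cV].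
  rewrite natrD !natrM ha; last exact: leq_trans SN.
  rewrite val // -cSU -(ffact_fact big) natrM; ring.
by apply/eqP; rewrite -(eqr_nat rat) !val.
Qed.

Lemma card_cpairs_rec (T : finType) l k (a : nat -> rat) (b : nat -> nat)
    (S : {set T}) :
    0 < #|S| ->
    (forall U : {set T}, 0 < #|U| -> #|ctuples l U 1| = (#|U|.-1)`! * b #|U|) ->
    (forall S' : {set T}, #|S'| < #|S| ->
      (#|cpairs l S' k|%:R = #|S'|`!%:R * a #|S'| :> rat)%R) ->
  (#|cpairs l S k.+1|%:R = (#|S|.-1)`!%:R *
    \sum_(1 <= m < #|S|.+1)
      (\sum_(1 <= d < #|S|.+1 | (d %| m)%N) d * b d)%N%:R * a (#|S| - m)%N :> rat)%R.
Proof.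
move=> S0 hb ha; have [x0 x0S] := card_gt0P S0.
rewrite (card_cpairs_by_orbit _ _ x0S) natr_sum.
(* Contribution of one orbit [U] of size [d]: the transitive tuples on [U] times the extensions of
   each. *)
pose g d : rat := (((d.-1)`! * b d)%N%:R * ((#|S| - d)%N`!%:R * d%:R *
       \sum_(1 <= m < #|S|.+1 | (d %| m)%N) a (#|S| - m)%N))%R.
transitivity (\sum_(U : {set T} | (x0 \in U) && (U \subset S)) g #|U|)%R.
  apply: eq_bigr => U /andP[x0U US].
  have U0 : 0 < #|U| by apply/card_gt0P; exists x0.
  rewrite natr_sum /g -hb // -sum1_card natr_sum mulr_suml.
  apply: eq_bigr => s0; rewrite (ctuples1E _ x0U) inE => /andP[s0c /eqP UE].
  by rewrite mul1r (card_agree s0c UE ha).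
rewrite sum_subsets_with_point // -(big_mkord xpredT
  (fun e => 'C(#|S|.-1, e)%:R * g e.+1)%R).
rewrite big_add1 /= mulr_sumr.
under [RHS]eq_bigr => m _.
  rewrite natr_sum mulr_suml big_add1 /= mulr_sumr big_mkcond /=.
over.
rewrite exchange_big /=; apply: eq_big_nat => e /andP[_ eS].
rewrite -big_mkcond /g /= big_add1 /= !mulr_sumr.
apply: eq_bigr => m _.
have eS1 : e <= #|S|.-1 by rewrite -ltnS prednK.
have -> : #|S| - e.+1 = #|S|.-1 - e by rewrite -{1}(prednK S0) subSS.
(* With [e = d - 1], the choices of [U] together with the two factorials in [g] give [(#|S| - 1)!],
   leaving [d * b d]. *)
rewrite -(bin_fact eS1) !natrM; ring.
Qed.

(** * Generating functions *)

Local Open Scope ring_scope.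

(* The number of subgroups of index [n] of the lattice [Z^l]. *)
Fixpoint sublattices (l n : nat) : nat :=
  if l is l'.+1 then (\sum_(d <- divisors n) d * sublattices l' d)%N
  else (n == 1)%N.

Lemma sum_divisors (F : nat -> nat) m N : (0 < m)%N -> (m <= N)%N ->
  (\sum_(d <- divisors m) F d = \sum_(1 <= d < N.+1 | d %| m) F d)%N.
Proof.
move=> m0 mN; rewrite -[RHS]big_filter; apply/perm_big/uniq_perm.
- exact: divisors_uniq.
- by rewrite filter_uniq ?iota_uniq.
move=> d; rewrite -dvdn_divisors // mem_filter mem_index_iota.
have [dm|//] := boolP (d %| m)%N.
by rewrite ltnS (dvdn_gt0 m0 dm) (leq_trans (dvdn_leq m0 dm) mN).
Qed.

(* The term m = 0 vanishes because 0^-1 = 0. *)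
Definition tpoly l N : {poly rat} :=
  \poly_(m < N.+1) ((sublattices l m)%:R / m%:R).

(** Coefficient of [x^n] in [f^k / k!]; truncating [f] at degree [N] does not affect it for
    [n <= N]. *)
Definition tcoef l N k n : rat := ((tpoly l N) ^+ k)`_n / k`!%:R.

Lemma coef0_tpoly l N : (tpoly l N)`_0 = 0.
Proof. by rewrite coef_poly /= invr0 mulr0. Qed.

Lemma tcoef0 l N n : tcoef l N 0 n = (n == 0)%:R.
Proof. by rewrite /tcoef expr0 coef1 divr1. Qed.

Lemma tcoefS0 l N k : tcoef l N k.+1 0 = 0.
Proof. by rewrite /tcoef exprS coefM big_ord1 coef0_tpoly !mul0r. Qed.

(** Coefficients of [(f^(k+1))' = (k+1) f' f^k]. Differentiation cancels the denominators of [f],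
    and [n < N] keeps clear of the truncation. *)
Lemma tcoef_rec l N k n : (n < N)%N ->
  n.+1%:R * tcoef l N k.+1 n.+1 =
  \sum_(1 <= m < n.+2) (sublattices l m)%:R * tcoef l N k (n.+1 - m)%N.
Proof.
move=> nN; have := congr1 (fun p : {poly rat} => p`_n) (deriv_exp (tpoly l N) k.+1).
rewrite coef_deriv coefMn coefM /= -[LHS]mulr_natl -[RHS]mulr_natl => E.
rewrite /tcoef mulrA E factS natrM -mulf_div divff ?pnatr_eq0 // mul1r.
rewrite big_add1 big_mkord mulr_suml; apply: eq_bigr => i _.
rewrite coef_deriv coef_poly ltnS (leq_trans (ltn_ord i)) //.
by rewrite subSS -[_ / _ *+ _]mulr_natr divfK ?pnatr_eq0 // mulrA.
Qed.

(** For [l = 0] only [m = 1] survives in the recursion, which then lowers [n] and [k] together. *)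
Lemma tcoef_l0 N k n : (n <= N)%N -> n`!%:R * tcoef 0 N k n = (n == k)%:R.
Proof.
elim: k n => [|k IH] [|n] nN; rewrite ?tcoef0 ?tcoefS0 ?mulr0 ?mul1r //.
rewrite factS mulnC natrM -mulrA tcoef_rec // eqSS -IH 1?ltnW //.
congr (_ * _); rewrite big_ltn // big1_seq ?addr0 ?mul1r ?subSS ?subn0 //.
by move=> [|[|m]] //=; rewrite ?mem_index_iota ?mul0r.
Qed.

(** * Closed form of the counts *)

Lemma norb0 (T : finType) (A : {set {perm T}}) : norb A set0 = 0%N.
Proof. by rewrite /norb imset0 cards0. Qed.

Lemma card_ctuples_set0 (T : finType) l : #|ctuples l (set0 : {set T}) 0| = 1%N.
Proof.
apply/eqP/cards1P; exists [tuple 1%g | i < l]; apply/setP=> s.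
rewrite !inE norb0 andbT; apply/commuting_onP/eqP => [[s1 _]|->].
  apply: eq_from_tnth => i; rewrite tnth_mktuple.
  by apply: perm_on_id (s1 i) _; rewrite cards0.
by split=> [i|i j]; rewrite !tnth_mktuple ?perm_on1.
Qed.

Lemma card_ctuples_l0 (T : finType) (S : {set T}) k :
  #|ctuples 0 S k| = (#|S| == k).
Proof.
have nE (s : 0.-tuple {perm T}) : norb [set q in s] S = #|S|.
  rewrite /norb card_in_imset // => x y _ _ E.
  have : x \in orb [set q in s] y by rewrite -E orb_refl.
  move/(@orb_invariant _ _ _ id); apply=> q; by rewrite inE tuple0.
have [<-|nk] := eqVneq #|S| k; last first.
  by apply: eq_card0 => s; rewrite inE nE (negPf nk) andbF.
apply/eqP/cards1P; exists [tuple]; apply/setP=> s; rewrite !inE nE eqxx andbT.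
rewrite [s]tuple0 eqxx; apply/commuting_onP; split; by case.
Qed.

(** Induction on [l], then on the size of [S] for all [k]. The step from [l] to [l.+1] uses level
    [l] only at [k = 1], for the transitive tuples. *)
Lemma card_ctuples (T : finType) l (S : {set T}) k :
  #|ctuples l S k|%:R = #|S|`!%:R * tcoef l #|T| k #|S|.
Proof.
elim: l S k => [|l IHl] S k.
  by rewrite card_ctuples_l0 tcoef_l0 // max_card.
have [n le_n] := ubnP #|S|; elim: n => // n IHn in S k le_n *.
have [S0|S0] := posnP #|S|.
  have SE := cards0_eq S0; rewrite S0 SE; case: k => [|k].
    by rewrite card_ctuples_set0 tcoef0 mulr1.
  rewrite tcoefS0 mulr0; apply/eqP; rewrite pnatr_eq0; apply/eqP/eq_card0 => s.
  by rewrite !inE norb0 andbF.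
case: k => [|k].
  rewrite tcoef0 (gtn_eqF S0) mulr0; apply/eqP; rewrite pnatr_eq0.
  apply/eqP/eq_card0 => s; rewrite !inE; apply/negbTE/negP => /andP[_].
  have [x xS] := card_gt0P S0; apply/negP; rewrite -lt0n; apply/card_gt0P.
  by exists (orb [set q in s] x); apply: imset_f.
rewrite card_cpairs (@card_cpairs_rec _ _ _ (tcoef l.+1 #|T| k) (sublattices l)) //.
- have := max_card (mem S); case: #|S| S0 => // m _ mT /=.
  rewrite factS mulnC natrM -mulrA tcoef_rec //.
  congr (_ * _); apply: eq_big_nat => i /andP[i0 im].
  by rewrite /= (@sum_divisors _ _ m.+1).
(* For [k = 1] the coefficient of degree [d] is [sublattices l d / d], and [d! / d] is [(d-1)!]. *)
- move=> U U0; apply/eqP; rewrite -(eqr_nat rat) IHl /tcoef expr1 divr1.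
  rewrite coef_poly ltnS max_card; case: #|U| U0 => // d _ /=.
  by rewrite factS mulnC !natrM -mulrA [d.+1%:R * _]mulrC divfK ?pnatr_eq0.
- move=> S' S'S; rewrite -card_cpairs IHn //.
  by apply: leq_trans S'S _; rewrite -ltnS.
Qed.

(** * Sublattice counts *)

(** The factors [x] and [y] are recovered from [x * y] as its gcds with [a] and [b]; the same gcds
    split any divisor of [a * b]. *)
Lemma perm_divisorsM a b : (0 < a)%N -> (0 < b)%N -> coprime a b ->
  perm_eq (divisors (a * b)) [seq (x * y)%N | x <- divisors a, y <- divisors b].
Proof.
move=> a0 b0 cab; have ab0 : (0 < a * b)%N by rewrite muln_gt0 a0.
apply: uniq_perm; first exact: divisors_uniq.
  apply: allpairs_uniq; rewrite ?divisors_uniq //.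
  have key x y : (x, y) \in [seq (x, y) | x <- divisors a, y <- divisors b] ->
      x = gcdn a (x * y) /\ y = gcdn b (x * y).
    case/allpairsP=> -[x' y'] /= [+ + [-> ->]].
    rewrite -!dvdn_divisors // => xa yb.
    rewrite Gauss_gcdl ?Gauss_gcdr.
    - by rewrite !(gcdn_idPr _).
    - by rewrite coprime_sym (coprime_dvdl xa).
    - by rewrite (coprime_dvdr yb).
  move=> [x y] [x' y'] /key[xE yE] /key[xE' yE'] /= E.
  by congr (_, _); [rewrite xE xE' E | rewrite yE yE' E].
move=> d; rewrite -dvdn_divisors //; apply/idP/allpairsP => [dab|[[x y]] /= []].
  exists (gcdn d a, gcdn d b); rewrite -!dvdn_divisors // !dvdn_gcdr; split=> //.
  apply/eqP; rewrite eqn_dvd Gauss_dvd ?dvdn_gcdl ?andbT.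
    by rewrite muln_gcdr dvdn_gcd dvdn_mull //= muln_gcdl dvdn_gcd dvdn_mulr.
  by rewrite (coprime_dvdl (dvdn_gcdr _ _)) // (coprime_dvdr (dvdn_gcdr _ _)).
by rewrite -!dvdn_divisors // => xa yb ->; apply: dvdn_mul.
Qed.

Lemma perm_divisorsX q m : prime q ->
  perm_eq (divisors (q ^ m)) [seq (q ^ i)%N | i <- iota 0 m.+1].
Proof.
move=> pq; have qm0 : (0 < q ^ m)%N by rewrite expn_gt0 prime_gt0.
apply: uniq_perm; first exact: divisors_uniq.
  by rewrite map_inj_uniq ?iota_uniq //; apply/expnI/prime_gt1.
move=> d; rewrite -dvdn_divisors //; apply/(dvdn_pfactor _ _ pq)/mapP => -[i].
  by move=> im ->; exists i => //; rewrite mem_iota.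
by rewrite mem_iota => im ->; exists i.
Qed.

(** [Bprime_power l q i] is the Gaussian binomial of [l + i - 1] over [i], and this is the
    q-analogue of the hockey-stick identity. The inductive step rests on [(q^(m+1) - 1) + q^(m+1)
    (q^l - 1) = q^(l+m+1) - 1]. *)
Lemma Bprime_power_rec l q m : prime q ->
  \sum_(i < m.+1) q%:R ^+ i * Bprime_power l q i = Bprime_power l.+1 q m.
Proof.
move=> pq; have nz i : q%:R ^+ i.+1 - 1 != 0 :> rat.
  rewrite subr_eq0 -natrX pnatr_eq1 -[1%N](expn0 q) eqn_exp2l ?prime_gt1 //.
elim: m => [|m IH].
  by rewrite big_ord1 expr0 /Bprime_power !big_ord0 mul1r.
rewrite big_ord_recr IH /= /Bprime_power.
have P0 : \prod_(i < m) (q%:R ^+ i.+1 - 1) != 0 :> rat by apply/prodf_neq0.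
(* Taking out the first factor [q^l - 1] on the left and the last factor on the right exposes the
   common product [N]. *)
rewrite [X in _ + _ * (X / _)]big_ord_recl [X in _ = X / _]big_ord_recr /=.
rewrite ![\prod_(i < m.+1) _]big_ord_recr /= addn0.
under [\prod_(i < m) (_ ^+ (l + _) - 1)]eq_bigr => i _ do rewrite addnS -addSn.
have := nz m; move: P0; rewrite exprD !exprS.
set P := \prod_(i < m) _; set N := \prod_(i < m) _ => P0 z.
by field; rewrite z.
Qed.

Lemma is_B_divisor_sum l (B : nat -> rat) : is_B l B ->
  is_B l.+1 (fun n => \sum_(d <- divisors n) d%:R * B d).
Proof.
move=> [[B1 BM] BX]; split; first split=> [|a b a0 b0 cab].
- by rewrite big_seq1 mul1r.
- rewrite (perm_big _ (perm_divisorsM a0 b0 cab)) big_allpairs_dep mulr_suml.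
  apply: eq_big_seq => x; rewrite -dvdn_divisors // => xa.
  rewrite mulr_sumr; apply: eq_big_seq => y; rewrite -dvdn_divisors // => yb.
  rewrite BM ?(dvdn_gt0 _ xa) ?(dvdn_gt0 _ yb) //; first by rewrite natrM; ring.
  by rewrite (coprime_dvdl xa) ?(coprime_dvdr yb).
- move=> q m pq; rewrite (perm_big _ (perm_divisorsX m pq)) big_map.
  rewrite -[m.+1]subn0 -/(index_iota 0 m.+1) big_mkord -Bprime_power_rec //.
  by apply: eq_bigr => i _; rewrite natrX BX.
Qed.

Lemma is_B_sublattices l : is_B l (fun n => (sublattices l n)%:R).
Proof.
elim: l => [|l /is_B_divisor_sum[[B1 BM] BX]].
  split=> [|q m pq /=].
    by split=> // a b _ _ _; rewrite /= muln_eq1 -natrM mulnb.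
  case: m => [|m]; first by rewrite /Bprime_power !big_ord0 divr1.
  rewrite /Bprime_power big_ord_recl expr0 subrr !mul0r.
  by rewrite -[1%N](expn0 q) eqn_exp2l ?prime_gt1.
have E n : \sum_(d <- divisors n) d%:R * (sublattices l d)%:R =
    (sublattices l.+1 n)%:R :> rat.
  by rewrite /= natr_sum; apply: eq_bigr => d _; rewrite natrM.
split; first split=> [|a b a0 b0 cab]; rewrite -?E ?BM //.
by move=> q m pq; rewrite -E BX.
Qed.

(** * Expansion of the power into a sum over tuples *)

Lemma coef_poly_exp (R : comNzRingType) (c : nat -> R) N k n :
  ((\poly_(m < N) c m) ^+ k)`_n =
  \sum_(nu : {ffun 'I_k -> 'I_N})
     ((\sum_(i < k) nu i)%N == n)%:R * \prod_(i < k) c (nu i).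
Proof.
rewrite poly_def -[k in LHS]card_ord -prodr_const bigA_distr_bigA coef_sum.
apply: eq_bigr => nu _.
have -> : \prod_(i < k) (c (nu i) *: 'X^(nu i)) =
    (\prod_(i < k) c (nu i)) *: 'X^(\sum_(i < k) nu i)%N.
  by rewrite scaler_prod -expr_sum.
by rewrite coefZ coefXn mulrC eq_sym.
Qed.

(* The sum ranges over k-tuples with entries in {1, ..., n}: the indicator
   vanishes as soon as some entry exceeds n. *)
Theorem theorem1p1 (l n k : nat) (hkn : (k <= n)%N)
    (B : nat -> rat) (hB : is_B l B) :
  (A l n k)%:R =
    (n`!)%:R / (k`!)%:R *
    \sum_(nu : {ffun 'I_k -> 'I_n.+1} | [forall i, (0 < nu i)%N])
      ((\sum_(i < k) nu i)%N == n)%:R *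
      \prod_(i < k) (B (nu i) / (nu i)%:R) :> rat.
Proof.
have -> : A l n k = #|ctuples l [set: 'I_n] k|.
  apply: eq_card => s; rewrite !inE; congr (_ && _).
  apply/idP/commuting_onP => [/forallP sC|[_ sC]].
    split=> [i|i j]; last by apply/eqP/(forallP (sC i)).
    by apply/subsetP=> x; rewrite inE.
  by apply/forallP=> i; apply/forallP=> j; apply/eqP/sC.
(* The ambient type is ['I_n], so [f] is truncated at degree [n] and the expansion ranges over
   entries in ['I_n.+1]. *)
rewrite card_ctuples cardsT !card_ord /tcoef coef_poly_exp mulrA [RHS]mulrAC.
congr (_ * _ / _); rewrite [RHS]big_mkcond; apply: eq_bigr => nu _.
(* A tuple with a zero entry contributes nothing, since [0^-1 = 0]; this matches the restriction to
   positive entries. *)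
case: ifPn => [/forallP nu0|]; last first.
  rewrite negb_forall => /existsP[i]; rewrite -eqn0Ngt => /eqP nui0.
  by rewrite [\prod_(_ < _) _](bigD1 i) //= nui0 invr0 mulr0 mul0r mulr0.
congr (_ * _); apply: eq_bigr => i _.
by rewrite (is_B_unique hB (is_B_sublattices l)).
Qed.
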